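(* Let $q=p^a$ be a prime power ($p$ prime, $a\ge 1$) and $1\le j\le d$. The graph $H_j(d,q)$ admits a $\Gamma$-distance magic labeling for some abelian group $\Gamma$ of order $q^d$ if and only if $p\mid\binom dj$. More precisely, if $p\mid\binom dj$, then $H_j(d,q)$ is $\mathbb F_q^d$-distance magic (with $\mathbb F_q^d$ regarded as an additive group). If $p\nmid\binom dj$, then, for every abelian group $\Gamma$ of order $q^d$, the graph $H_j(d,q)$ admits no affinely generating $\Gamma$-magic map, and it admits a generating $\Gamma$-magic map if and only if $\Gamma$ is cyclic.
   Context: Let $\mathcal A$ be a set with $q$ elements. The Hamming distance of $x,y\in\mathcal A^d$ is $d_H(x,y)=|\{i:x_i\neq y_i\}|$. $H_j(d,q)$ is the graph with vertex set $\mathcal A^d$ in which two vertices are adjacent if and only if $d_H(x,y)=j$. For a finite abelian group $\Gamma$ (written additively), a map $f\colon V(G)\to\Gamma$ is a $\Gamma$-magic map if there is $\gamma\in\Gamma$ with $\sum_{u\in N_G(v)}f(u)=\gamma$ for every $v\in V(G)$, where $N_G(v)$ is the open neighborhood. It is generating if $\langle f(v)\mid v\in V(G)\rangle=\Gamma$, and affinely generating if $\langle f(v)-f(w)\mid v,w\in V(G)\rangle=\Gamma$. A $\Gamma$-distance magic labeling is a bijective $\Gamma$-magic map; $G$ is $\Gamma$-distance magic if it admits one. *)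

(* Defs.v *)
From HB Require Import structures.
From mathcomp Require Import all_boot all_order all_algebra all_fingroup all_solvable.
Set Implicit Arguments.
Unset Strict Implicit.
Unset Printing Implicit Defensive.
Import GRing.Theory.

Definition hamming_dist (A : finType) (d : nat) (x y : {ffun 'I_d -> A}) : nat :=
  #|[set i | x i != y i]|.

(* H_j(d,q) with q = #|A|, as an adjacency relation; irreflexive for 0 < j. *)
Definition hamming_graph (A : finType) (d j : nat) : rel {ffun 'I_d -> A} :=
  fun x y => hamming_dist x y == j.

Definition magic_map (V : finType) (e : rel V) (G : finZmodType) (f : V -> G) : Prop :=
  exists g : G, forall v : V, (\sum_(u | e v u) f u)%R = g.

(* A finZmodType is canonically a finGroupType whose product is +%R, so <<_>>
   below is the additive subgroup generated by a set, and [cyclic] applies to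
   [set: G]. *)
Definition generating (V : finType) (G : finZmodType) (f : V -> G) : Prop :=
  <<[set f v | v : V]>>%g = [set: G].

Definition affinely_generating (V : finType) (G : finZmodType) (f : V -> G) : Prop :=
  <<[set (f v - f w)%R | v : V, w : V]>>%g = [set: G].

Definition distance_magic_labeling (V : finType) (e : rel V) (G : finZmodType)
    (f : V -> G) : Prop :=
  bijective f /\ magic_map e f.

Definition distance_magic (V : finType) (e : rel V) (G : finZmodType) : Prop :=
  exists f : V -> G, distance_magic_labeling e f.

(* Main.v *)
(* Let J_k sum a function over the line through a vertex in direction k, and
   let A_S sum it over the vertices differing from the given one exactly in the
   coordinates of S, so that the neighbour sum N of H_j(d,q) is the sum of the
   A_S with |S| = j. Then A_(S + k) = A_S (J_k - 1), so modulo constant maps N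
   acts as (-1)^j 'C(d, j) on every f all of whose line sums are constant.
   The coordinates of F_q^d have constant line sums, which settles the case
   p | 'C(d, j). If p does not divide 'C(d, j), take f magic with p f constant:
   since J_k^2 = q J_k, passing from f to J_k f makes line sums constant one
   direction at a time, and going back shows that f is constant. Multiplying by
   powers of p then makes every magic map into a p-group constant. *)
Require Import Defs.
From HB Require Import structures.
From mathcomp Require Import all_boot all_order all_algebra all_fingroup all_solvable.
From mathcomp Require Import finfield.

Set Implicit Arguments.
Unset Strict Implicit.
Unset Printing Implicit Defensive.
Import GRing.Theory.
Local Open Scope ring_scope.

(** * Constant maps and induction on finite sets *)

Definition constant_map (V : Type) (G : Type) (f : V -> G) : Prop :=
  exists c, forall v, f v = c.

Lemma constant_mapD (V : Type) (G : zmodType) (f g : V -> G) :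
  constant_map f -> constant_map g -> constant_map (fun v => f v + g v).
Proof. by move=> [c fc] [c' gc]; exists (c + c') => v; rewrite fc gc. Qed.

Lemma constant_mapMz (V : Type) (G : zmodType) (f : V -> G) (z : int) :
  constant_map f -> constant_map (fun v => f v *~ z).
Proof. by move=> [c fc]; exists (c *~ z) => v; rewrite fc. Qed.

Lemma constant_map_sum (V : Type) (G : zmodType) (I : finType) (P : pred I)
    (F : I -> V -> G) :
  (forall i, P i -> constant_map (F i)) ->
  constant_map (fun v => \sum_(i | P i) F i v).
Proof.
(* One constant is chosen per index, with default 0 outside [P]. *)
move=> Fc; have /fin_all_exists[c cP] i : exists c, P i -> forall v, F i v = c.
  by case Pi: (P i); [have [c] := Fc i Pi; exists c | exists 0].
by exists (\sum_(i | P i) c i) => v; apply: eq_bigr => i /cP.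
Qed.

Lemma eq_constant_map (V G : Type) (f g : V -> G) :
  f =1 g -> constant_map f -> constant_map g.
Proof. by move=> fg [c fc]; exists c => v; rewrite -fg. Qed.

(** Bezout: if u m + w n = 1, then f = u (m f) + w (n f). *)
Lemma constant_map_coprime (V : Type) (G : zmodType) (f : V -> G) (m n : nat) :
  coprime m n -> constant_map (fun v => f v *+ m) ->
  constant_map (fun v => f v *+ n) -> constant_map f.
Proof.
move=> cmn [c fm] [c' fn].
have /coprimezP[[u w] /= uw] : coprimez m%:Z n%:Z by [].
exists (c *~ u + c' *~ w) => v.
rewrite -(fm v) -(fn v) !pmulrn -!mulrzA.
by rewrite -mulrzDr mulrC [n%:Z * w]mulrC uw.
Qed.

Lemma finset_ind (T : finType) (P : {set T} -> Prop) :
  P set0 -> (forall i (S : {set T}), i \notin S -> P S -> P (i |: S)) -> forall S, P S.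
Proof.
move=> P0 PU S; have [n] := ubnP #|S|; elim: n S => // n IH S Sn.
have [->//|[i iS]] := set_0Vmem S.
rewrite -(setD1K iS); apply: PU; first by rewrite setD11.
by apply: IH; rewrite (cardsD1 i) iS in Sn.
Qed.

(** * Line sums and shell sums *)

Definition set_coord (A : finType) (d : nat) (v : {ffun 'I_d -> A}) (i : 'I_d)
    (a : A) : {ffun 'I_d -> A} :=
  [ffun k => if k == i then a else v k].

Definition line_sum (A : finType) (d : nat) (G : zmodType) (i : 'I_d)
    (f : {ffun 'I_d -> A} -> G) (v : {ffun 'I_d -> A}) : G :=
  \sum_a f (set_coord v i a).

Definition diff_set (A : finType) (d : nat) (v u : {ffun 'I_d -> A}) :
    {set 'I_d} := [set i | v i != u i].

Definition shell_sum (A : finType) (d : nat) (G : zmodType) (S : {set 'I_d})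
    (f : {ffun 'I_d -> A} -> G) (v : {ffun 'I_d -> A}) : G :=
  \sum_(u | diff_set v u == S) f u.

Lemma line_sum_constant (A : finType) (d : nat) (G : zmodType) (i : 'I_d)
    (f : {ffun 'I_d -> A} -> G) :
  constant_map f -> constant_map (line_sum i f).
Proof.
by move=> [c fc]; exists (\sum_(a : A) c) => v; apply: eq_bigr => a _.
Qed.

Lemma line_sumC (A : finType) (d : nat) (G : zmodType) (i k : 'I_d)
    (f : {ffun 'I_d -> A} -> G) :
  line_sum i (line_sum k f) =1 line_sum k (line_sum i f).
Proof.
have [->//|ik v] := eqVneq i k.
rewrite /line_sum exchange_big; apply: eq_bigr => a _; apply: eq_bigr => b _.
congr f; apply/ffunP => l; rewrite !ffunE.
by have [->|//] := eqVneq l k; rewrite eq_sym (negbTE ik).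
Qed.

Lemma line_sum_idem (A : finType) (d : nat) (G : zmodType) (i : 'I_d)
    (f : {ffun 'I_d -> A} -> G) v :
  line_sum i (line_sum i f) v = line_sum i f v *+ #|A|.
Proof.
rewrite -sumr_const; apply: eq_bigr => b _; apply: eq_bigr => a _.
by congr f; apply/ffunP => l; rewrite !ffunE; case: eqP.
Qed.

Lemma shell_sum0 (A : finType) (d : nat) (G : zmodType)
    (f : {ffun 'I_d -> A} -> G) : shell_sum set0 f =1 f.
Proof.
move=> v; rewrite /shell_sum (big_pred1 v) // => u; apply/eqP/eqP => [D0|->].
  apply/ffunP => i; apply/esym/eqP; have := in_set0 i.
  by rewrite -D0 inE => /negbFE.
by apply/setP => i; rewrite !inE eqxx.
Qed.

(** The shells of [S] and of [i |: S] are told apart by whether the vertex differs from [v] at [i].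
    Together they are the disjoint union of the lines in direction [i] through the vertices of the
    shell of [S]. *)
Lemma shell_sumU1 (A : finType) (d : nat) (G : zmodType) (i : 'I_d)
    (S : {set 'I_d}) (f : {ffun 'I_d -> A} -> G) v :
  i \notin S ->
  shell_sum (i |: S) f v = shell_sum S (line_sum i f) v - shell_sum S f v.
Proof.
move=> iS; have diffU1 w : i \in diff_set v w ->
    (diff_set v w == i |: S) = (diff_set v w :\ i == S).
  by move=> iD; apply/eqP/eqP => [->|<-]; rewrite ?setU1K ?setD1K.
have diffS w : i \notin diff_set v w ->
    (diff_set v w == S) = (diff_set v w :\ i == S).
  by rewrite -disjoints1 disjoint_sym => /setDidPl->.
apply: (canRL (addrK _)).
transitivity (\sum_(w | diff_set v w :\ i == S) f w).
  rewrite [RHS](bigID (fun w => i \in diff_set v w)) /=.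
  congr (_ + _); apply: eq_bigl => w.
    case: (boolP (i \in _)) => iD; first by rewrite andbT diffU1.
    by rewrite andbF; apply: contraNF iD => /eqP->; rewrite setU11.
  case: (boolP (i \in _)) => iD; last by rewrite andbT diffS.
  by rewrite andbF; apply: contraTF iD => /eqP->.
(* Resetting coordinate [i] to [v i] sends [w] to the vertex of the shell of [S] on its line, so the
   fibres are whole lines. *)
rewrite (partition_big (fun w => set_coord w i (v i))
           (fun u => diff_set v u == S)) /=; last first.
  move=> w /eqP <-; apply/eqP/setP => k; rewrite !inE ffunE.
  by case: (k =P i) => [->|]; rewrite ?eqxx.
apply: eq_bigr => u /eqP vuS.
have viu : v i = u i by apply/eqP; move: iS; rewrite -vuS inE negbK.
(* The line through [u] is parametrised by its [i]-th coordinate. *)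
rewrite (reindex_onto (set_coord u i) (fun w => w i)) /=.
  apply: eq_bigl => a; rewrite ffunE !eqxx andbT; apply/andP; split.
    rewrite -vuS; apply/eqP/setP => k; rewrite !inE ffunE.
    by case: (k =P i) => [->|]; rewrite ?viu ?eqxx.
  by apply/eqP/ffunP => k; rewrite !ffunE; case: (k =P i) => [->|].
move=> w /andP[_ /eqP <-]; apply/ffunP => k; rewrite !ffunE.
by case: (k =P i) => [->|].
Qed.

Lemma eq_shell_sum (A : finType) (d : nat) (G : zmodType) (S : {set 'I_d})
    (f g : {ffun 'I_d -> A} -> G) :
  f =1 g -> shell_sum S f =1 shell_sum S g.
Proof. by move=> fg v; apply: eq_bigr => u _; apply: fg. Qed.

(** By [shell_sumU1] shell sums are built from line sums, which commute with each other. *)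
Lemma shell_sum_line_sum (A : finType) (d : nat) (G : zmodType) (S : {set 'I_d})
    (k : 'I_d) (f : {ffun 'I_d -> A} -> G) v :
  shell_sum S (line_sum k f) v = line_sum k (shell_sum S f) v.
Proof.
elim/finset_ind: S f v => [|i S iS IH] f v.
  by rewrite shell_sum0; apply: eq_bigr => a _; rewrite shell_sum0.
rewrite shell_sumU1 // (eq_shell_sum S (line_sumC i k f)) !IH -sumrB.
by apply: eq_bigr => a _; rewrite shell_sumU1.
Qed.

Lemma shell_sum_constant (A : finType) (d : nat) (G : zmodType) (S : {set 'I_d})
    (f : {ffun 'I_d -> A} -> G) :
  constant_map f -> constant_map (shell_sum S f).
Proof.
elim/finset_ind: S f => [|i S iS IH] f fc.
  by apply: eq_constant_map fc => v; rewrite shell_sum0.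
have fSc := constant_mapMz (-1) (IH _ fc).
apply: eq_constant_map (constant_mapD (IH _ (line_sum_constant i fc)) fSc) => v.
by rewrite shell_sumU1 // mulrN1z.
Qed.

(** In [shell_sumU1] the term with [line_sum i f] is now constant, so each new element of [S] only
    flips the sign. *)
Lemma shell_sum_line_constant (A : finType) (d : nat) (G : zmodType)
    (S : {set 'I_d}) (f : {ffun 'I_d -> A} -> G) :
  (forall k, constant_map (line_sum k f)) ->
  constant_map (fun v => shell_sum S f v - f v *~ (-1) ^+ #|S|).
Proof.
move=> fc; elim/finset_ind: S => [|i S iS IH].
  by exists 0 => v; rewrite shell_sum0 cards0 subrr.
have fSc := constant_mapMz (-1) IH.
apply: eq_constant_map (constant_mapD (shell_sum_constant S (fc i)) fSc) => v.
rewrite shell_sumU1 // cardsU1 iS exprS mulN1r mulrN1z mulrNz.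
by rewrite opprK opprB addrA addrAC.
Qed.

(** * Neighbour sums and magic maps of the Hamming graph *)

Lemma hamming_sumE (A : finType) (d j : nat) (G : zmodType)
    (f : {ffun 'I_d -> A} -> G) v :
  \sum_(u | @hamming_graph A d j v u) f u
    = \sum_(S : {set 'I_d} | #|S| == j) shell_sum S f v.
Proof.
rewrite (partition_big (diff_set v) (fun S : {set 'I_d} => #|S| == j)) //=.
apply: eq_bigr => S /eqP Sj; apply: eq_bigl => u.
rewrite /hamming_graph /hamming_dist -/(diff_set v u).
by case: (_ =P S) => [->|]; rewrite ?Sj ?eqxx ?andbF.
Qed.

Lemma magic_map_line_sum (A : finType) (d j : nat) (G : finZmodType)
    (k : 'I_d) (f : {ffun 'I_d -> A} -> G) :
  magic_map (@hamming_graph A d j) f ->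
  magic_map (@hamming_graph A d j) (line_sum k f).
Proof.
move=> /(line_sum_constant k); apply: eq_constant_map => v.
rewrite hamming_sumE /line_sum.
under eq_bigr do rewrite hamming_sumE.
by rewrite exchange_big; apply: eq_bigr => S _; rewrite shell_sum_line_sum.
Qed.

Lemma magic_map_constant (A : finType) (d j : nat) (G : finZmodType)
    (f : {ffun 'I_d -> A} -> G) :
  constant_map f -> magic_map (@hamming_graph A d j) f.
Proof.
move=> fc; have := constant_map_sum (fun S _ => shell_sum_constant S fc).
move=> /(_ (fun S => #|S| == j)); apply: eq_constant_map => v.
by rewrite hamming_sumE.
Qed.

Lemma hamming_sum_line_constant (A : finType) (d j : nat) (G : zmodType)
    (f : {ffun 'I_d -> A} -> G) :
  (forall k, constant_map (line_sum k f)) ->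
  constant_map (fun v => \sum_(u | @hamming_graph A d j v u) f u
                           - f v *+ 'C(d, j) *~ (-1) ^+ j).
Proof.
move=> fc.
have := constant_map_sum (fun S _ => shell_sum_line_constant S fc).
move=> /(_ (fun S => #|S| == j)); apply: eq_constant_map => v.
rewrite hamming_sumE sumrB; congr (_ - _).
rewrite (eq_bigr (fun=> f v *~ (-1) ^+ j)) => [|S /eqP-> //].
by rewrite sumr_const -cardsE card_draws card_ord !pmulrn mulrzAC.
Qed.

Lemma magic_map_torsion (A : finType) (d j p : nat) (G : finZmodType)
    (f : {ffun 'I_d -> A} -> G) :
  coprime p 'C(d, j) -> (p %| #|A|)%N -> magic_map (@hamming_graph A d j) f ->
  constant_map (fun v => f v *+ p) -> constant_map f.
Proof.
move=> pC pA.
(* s lists the directions whose line sums are not yet known to be constant. *)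
suff lines (s : seq 'I_d) : forall f : {ffun 'I_d -> A} -> G,
    (forall k, k \notin s -> constant_map (line_sum k f)) ->
    magic_map (@hamming_graph A d j) f ->
    constant_map (fun v => f v *+ p) -> constant_map f.
  by apply: (lines (enum 'I_d)) => k; rewrite mem_enum.
elim: s => [|i s IH] {}f fs fm fp.
  (* All line sums are constant here, so the neighbour sum is [(-1) ^+ j] times 'C(d, j) f up to a
     constant. As it is constant itself, so is 'C(d, j) f. *)
  apply: (constant_map_coprime pC fp).
  have fl := constant_mapMz (- (-1) ^+ j)
    (hamming_sum_line_constant j (fun k => fs k isT)).
  have fmz := constant_mapMz ((-1) ^+ j) fm.
  apply: eq_constant_map (constant_mapD fl fmz) => v /=.
  rewrite mulrzBl !mulrNz -mulrzA -expr2 sqrr_sign mulr1z.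
  by rewrite opprK addrAC addNr add0r.
have ifp : constant_map (fun v => line_sum i f v *+ p).
  by apply: eq_constant_map (line_sum_constant i fp) => v; rewrite -sumrMnl.
(* For [f] only direction [i] is missing. That [line_sum i f] is constant comes from a second use of
   the induction hypothesis, on [line_sum i f] itself. *)
apply: (IH f) => // k ks; have [->|ki] := eqVneq k i; last first.
  by apply: fs; rewrite inE negb_or ki.
apply: (IH (line_sum i f)) (magic_map_line_sum i fm) (ifp) => {k ks}k ks.
have [->|ki] := eqVneq k i.
  (* Summing twice in direction [i] multiplies by [#|A|], a multiple of [p], and p times
     [line_sum i f] is constant. *)
  have /dvdnP[m Am] := pA.
  apply: eq_constant_map (constant_mapMz m ifp) => v.
  by rewrite line_sum_idem Am mulnC mulrnA pmulrn.
have /(line_sum_constant i) : constant_map (line_sum k f).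
  by apply: fs; rewrite inE negb_or ki.
by apply: eq_constant_map; apply: line_sumC.
Qed.

(** By Lagrange p^n f = 0. If p^(n+1) f is constant, then p^n f is a magic map whose multiple by p
    is constant, so [magic_map_torsion] removes one factor p at a time. *)
Lemma magic_map_pgroup (A : finType) (d j p n : nat) (G : finZmodType)
    (f : {ffun 'I_d -> A} -> G) :
  coprime p 'C(d, j) -> (p %| #|A|)%N -> #|G| = (p ^ n)%N ->
  magic_map (@hamming_graph A d j) f -> constant_map f.
Proof.
move=> pC pA Gp.
have : constant_map (fun v => f v *+ p ^ n).
  exists 0 => v; rewrite -FinRing.zmodXgE -Gp -cardsT; apply: expg_cardG.
  exact: in_setT.
elim: n {Gp} f => [|n IH] f; first by move=> fc _; apply: eq_constant_map fc.
move=> fc fm; apply: (IH f) => //.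
apply: (magic_map_torsion pC pA).
  have := constant_mapMz (p ^ n)%N fm; apply: eq_constant_map => v.
  by rewrite -pmulrn sumrMnl.
by apply: eq_constant_map fc => v; rewrite -mulrnA expnSr.
Qed.

(** * Labelling by row vectors over a finite field *)

Lemma row_labeling_magic (A : finType) (d j p : nat) (F : finFieldType)
    (phi : A -> F) :
  p \in [pchar F] -> (p %| #|A|)%N -> (p %| 'C(d, j))%N ->
  magic_map (@hamming_graph A d j) (fun v : {ffun 'I_d -> A} => \row_i phi (v i)).
Proof.
move=> pF pA /dvdnP[m Cm]; set f := fun v => _.
have pZ (x : 'rV[F]_d) : x *+ p = 0 by rewrite -scaler_nat (pcharf0 pF) scale0r.
have fl k : constant_map (line_sum k f).
  (* Along direction [k], entry [k] runs through all values of [phi], while any other entry is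
     repeated [#|A|] times and sums to 0 in characteristic [p]. *)
  exists (\row_i if i == k then \sum_a phi a else 0) => v.
  apply/rowP => i; rewrite summxE mxE.
  under eq_bigr do rewrite mxE ffunE.
  case: eqP => // _; rewrite sumr_const.
  by have /dvdnP[b ->] := pA; rewrite mulrnA -mulr_natr (pcharf0 pF) mulr0.
apply: eq_constant_map (hamming_sum_line_constant j fl) => v.
by rewrite Cm mulrnA pZ mul0rz subr0.
Qed.

Lemma row_labeling_bij (A : finType) (d : nat) (F : finFieldType)
    (phi : A -> F) :
  bijective phi -> bijective (fun v : {ffun 'I_d -> A} => \row_i phi (v i)).
Proof.
case=> psi phiK psiK; exists (fun r : 'rV_d => [ffun i => psi (r 0 i)]) => [v|r].
  by apply/ffunP => i; rewrite ffunE mxE.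
by apply/rowP => i; rewrite mxE ffunE psiK.
Qed.

(** * Subgroups generated by constant maps *)

Lemma not_affinely_generating_constant (V : finType) (G : finZmodType)
    (f : V -> G) :
  (1 < #|G|)%N -> constant_map f -> ~ affinely_generating f.
Proof.
move=> G1 [c fc] fG.
have : <<[set f v - f w | v : V, w : V]>>%g \subset [1 G]%g.
  rewrite gen_subG; apply/subsetP => _ /imset2P[v w _ _ ->].
  by rewrite !fc subrr inE.
by rewrite fG => /subset_leq_card; rewrite cards1 cardsT leqNgt G1.
Qed.

(** The vertex [v0] ensures that the image is [[set c]] and not empty. *)
Lemma generating_constant (V : finType) (G : finZmodType) (c : G) (v0 : V) :
  generating (fun _ : V => c) <-> <[c]>%g = [set: G].
Proof.
rewrite /generating; have -> // : [set c | _ : V] = [set c].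
by apply/setP => x; rewrite inE; apply/imsetP/eqP => [[]|->] //; exists v0.
Qed.

(* Prime power alphabets: existence of labelings and the cyclic criterion *)
Local Close Scope ring_scope.

Theorem corollary5p6 (p a q d j : nat) (A : finType)
    (hp : prime p) (ha : 1 <= a) (hq : q = p ^ a) (hA : #|A| = q)
    (hj : 1 <= j <= d) :
  ((exists G : finZmodType, #|G| = q ^ d /\ distance_magic (@hamming_graph A d j) G)
     <-> p %| 'C(d, j))
  /\
  (p %| 'C(d, j) ->
     forall F : finFieldType, #|F| = q ->
       distance_magic (@hamming_graph A d j) 'rV[F]_d)
  /\
  (~~ (p %| 'C(d, j)) ->
     forall G : finZmodType, #|G| = q ^ d ->
       ~ (exists f : {ffun 'I_d -> A} -> G,
            magic_map (@hamming_graph A d j) f /\ affinely_generating f)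
       /\
       ((exists f : {ffun 'I_d -> A} -> G,
            magic_map (@hamming_graph A d j) f /\ generating f)
          <-> cyclic [set: G])).
Proof.
have d_gt0 : 0 < d by case/andP: hj; apply: leq_trans.
have pA : p %| #|A| by rewrite hA hq -(prednK ha) expnS dvdn_mulr.
have q_gt1 : 1 < q.
  by rewrite hq -(exp1n a) ltn_exp2r ?prime_gt1.
have qd_gt1 : 1 < q ^ d by rewrite -(exp1n d) ltn_exp2r.
have /card_gt0P[a0 _] : 0 < #|A| by rewrite hA ltnW.
have magicC (G : finZmodType) (f : {ffun 'I_d -> A} -> G) :
    ~~ (p %| 'C(d, j)) ->
    #|G| = q ^ d -> magic_map (@hamming_graph A d j) f -> constant_map f.
  rewrite hq -expnM -prime_coprime // => pC.
  exact: magic_map_pgroup.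
have labeling (F : finFieldType) : p %| 'C(d, j) -> #|F| = q ->
    distance_magic (@hamming_graph A d j) 'rV[F]_d.
  move=> pC Fq.
  have pF : p \in [pchar F]%R by apply: (@card_finPcharP F p a); rewrite ?Fq.
  have AF : #|A| = #|F| by rewrite hA Fq.
  (* Any bijection from [A] to [F] will do; this one matches the enumerations. *)
  pose phi x : F := enum_val (cast_ord AF (enum_rank x)).
  have phi_bij : bijective phi.
    exists (fun y => enum_val (cast_ord (esym AF) (enum_rank y))) => x.
      by rewrite /phi enum_valK cast_ordK enum_rankK.
    by rewrite /phi enum_valK cast_ordKV enum_rankK.
  exists (fun v : {ffun 'I_d -> A} => \row_i phi (v i))%R.
  split; first exact: row_labeling_bij.
  exact: row_labeling_magic pF pA pC.
split; [split|split].
- move=> [G [Gq [f [f_bij fm]]]]; apply/negPn/negP => pC.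
  (* A constant map cannot reach two distinct elements of [G]. *)
  have [c fc] := magicC G f pC Gq fm; have [g fK gK] := f_bij.
  have := qd_gt1; rewrite -Gq -cardsT => /card_gt1P[x [y [_ _]]].
  by rewrite -(gK x) -(gK y) !fc eqxx.
- move=> pC; have [F pF Fq] := PrimePowerField hp ha.
  exists 'rV[F]_d; split; last by apply: labeling; rewrite // Fq.
  by rewrite card_mx mul1n Fq hq.
- by move=> pC F; apply: labeling.
move=> pC G Gq; split.
  move=> [f [fm]]; apply: not_affinely_generating_constant; first by rewrite Gq.
  exact: magicC fm.
split=> [[f [fm fG]]|/cyclicP[c cG]].
  (* A generating magic map is constant, so its one value generates [G]; conversely, the constant
     map at a generator is magic. *)
  have [c fc] := magicC G f pC Gq fm; apply/cyclicP; exists c.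
  apply/esym/(generating_constant c [ffun=> a0]); rewrite /generating -fG.
  by congr (<<_>>)%g; apply: eq_imset => v; rewrite fc.
exists (fun=> c); split; first by apply: magic_map_constant; exists c.
exact/(generating_constant c [ffun=> a0]).
Qed.
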